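(* Let $\kappa,\sigma$ be positive integers and let $a,b$ be real numbers with $a,b,a+b\notin\{-1,-2,\dots\}$. For positive integers $N$ let $H_{n}^{N}=h_n^{\kappa,\sigma;\,a,b,N}$ be the Krall Hahn polynomials defined in the context, where $n\ge 0$ is an integer with $n+a+b-1\ne 0$ and $n+a+b\ne 0$. If the conditions $a>\kappa$ and $b>\sigma$ do not both hold, assume that the polynomials $H_n^N$ have degree $n$. Write $\Lambda_\sigma^{b,a}(n)=(-1)^{\sigma+b}(b+1)_{\sigma-b}(n+a-1)_b(n+1)_b$ for $b\in\{1,\dots,\sigma\}$, and correspondingly $\Lambda_\kappa^{a,b}(n)=(-1)^{\kappa+a}(a+1)_{\kappa-a}(n+b-1)_a(n+1)_a$ for $a\in\{1,\dots,\kappa\}$. (i) If $a\notin\{1,\dots,\kappa\}$ and $b\notin\{1,\dots,\sigma\}$, then $$\lim_{N\to\infty}\frac{H_n^N((1-x)N/2)}{(a-\kappa)_\kappa(b-\sigma)_\sigma N^{\kappa+\sigma}}=\frac{(2n+a+b-2)_3}{(n+a+b)(n+a+b-1)^2}P_n^{a-1,b-1}(x).$$ (ii) If $a\notin\{1,\dots,\kappa\}$, $b\in\{1,\dots,\sigma\}$ and $n\ge1$, then $$\lim_{N\to\infty}\frac{H_n^N((1-x)N/2)}{(a-\kappa)_\kappa N^{\kappa+\sigma-b}}=\frac{n(2n+a+b-2)(2n+a+b)}{(n+b)(n+a+b-1)_2}\Lambda_\sigma^{b,a}(n)P_n^{a-1,b;\infty}(x).$$ (iii) If $a\in\{1,\dots,\kappa\}$,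 $b\notin\{1,\dots,\sigma\}$ and $n\ge1$, then $$\lim_{N\to\infty}\frac{H_n^N((1-x)N/2)}{(b-\sigma)_\sigma N^{\kappa+\sigma-a}}=\frac{n(2n+a+b-2)(2n+a+b)}{(-1)^n(n+a)(n+a+b-1)_2}\Lambda_\kappa^{a,b}(n)P_n^{b-1,a;\infty}(-x).$$ (iv) If $a\in\{1,\dots,\kappa\}$ and $b\in\{1,\dots,\sigma\}$, then $$\lim_{N\to\infty}\frac{H_n^N((1-x)N/2)}{N^{\kappa+\sigma-a-b}}=\Lambda_\kappa^{a,b}(n)\Lambda_\sigma^{b,a}(n)\,P_n^{\infty,\infty;\,a,b}(x).$$
   Context: $(y)_j=y(y+1)\cdots(y+j-1)$ is the Pochhammer symbol; binomials with real upper entry are generalized. Jacobi polynomials: $P_n^{\alpha,\beta}(x)=2^{-n}\sum_{j=0}^n\binom{n+\alpha}{j}\binom{n+\beta}{n-j}(x-1)^{n-j}(x+1)^j$ for $n\ge0$. Degenerate ($u=\infty$) Krall Jacobi polynomials: for real $\alpha$, a positive integer $k$ and $n\ge1$, $P_n^{\alpha,k;\infty}(x)=P_n^{\alpha,k}(x)+\frac{n+k}{n}P_{n-1}^{\alpha,k}(x)$. Degenerate ($u=v=\infty$) two-sided Krall Jacobi polynomials: for positive integers $k,s$ and $n\ge 2$, $$P_n^{\infty,\infty;\,k,s}(x)=\begin{vmatrix} P_n^{k,s}(x)&P_{n-1}^{k,s}(x)&P_{n-2}^{k,s}(x)\\ 1&\frac{n}{n+k}&\frac{(n-1)_2}{(n+k-1)_2}\\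 1&\frac{-n}{n+s}&\frac{(n-1)_2}{(n+s-1)_2}\end{vmatrix},$$ with initial values $P_0^{\infty,\infty;\,k,s}(x)=1$ and $$P_1^{\infty,\infty;\,k,s}(x)=\begin{vmatrix}\frac{1}{1+k}&\frac{T_s^k(-1)}{(2)_k}\\ \frac{-1}{1+s}&\frac{T_k^s(-1)}{(2)_s}\end{vmatrix}P_1^{k,s}(x)-\begin{vmatrix}1&\frac{T_s^k(-1)}{(2)_k}\\ 1&\frac{T_k^s(-1)}{(2)_s}\end{vmatrix},$$ where $T_s^k(n)=\frac{2^{k+s}\Gamma(k)}{(n+s+1)_k}$ and, exchanging the roles of $k$ and $s$, $T_k^s(n)=\frac{2^{k+s}\Gamma(s)}{(n+k+1)_s}$. Hahn polynomials: for $N\ge n\ge 0$, $N$ a positive integer, $h_n^{a,b,N}(x)=\frac{(a+1)_n}{n!}\,{}_3F_2\!\left(-n,-x,n+a+b+1;\,a+1,-N;\,1\right)=\frac1{n!}\sum_{j=0}^n\frac{(-n)_j(-x)_j(n+a+b+1)_j(a+j+1)_{n-j}}{(-N)_j\,j!}$; $h_{-1}^{a,b,N}=h_{-2}^{a,b,N}=0$. For real $w$: $\lambda_j^{w}(x)=\prod_{i=0}^{j-1}(x-i(w+i+1))$ and $\theta_x^{w}=x(x+w+1)$. Dual Hahn polynomials, for real parameters $A,B,M$: $R_n^{A,B,M}(x)=\sum_{j=0}^n\frac{(-n)_j(-M+j)_{n-j}(A+j+1)_{n-j}}{(-1)^j j!}\lambda_j^{A+B}(x)$. Set $S_k^{a,b,N}(n)=R_k^{-b,-a,a+b+N}(\theta_{-n-1}^{-a-b})$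 (so $S_k^{b,a,N}(n)=R_k^{-a,-b,a+b+N}(\theta_{-n-1}^{-a-b})$). Krall Hahn polynomials: for positive integers $\kappa,\sigma,N$ and $0\le n\le N$, $$h_n^{\kappa,\sigma;\,a,b,N}(x)=\begin{vmatrix} h_n^{a,b,N}(x)&h_{n-1}^{a,b,N}(x)&h_{n-2}^{a,b,N}(x)\\ \frac{(n+b-1)_2}{(n+a+b-1)_2}S_\kappa^{b,a,N}(n)&\frac{n+b-1}{n+a+b-1}S_\kappa^{b,a,N}(n-1)&S_\kappa^{b,a,N}(n-2)\\ \frac{(n+a-1)_2}{(n+a+b-1)_2}S_\sigma^{a,b,N}(n)&-\frac{n+a-1}{n+a+b-1}S_\sigma^{a,b,N}(n-1)&S_\sigma^{a,b,N}(n-2)\end{vmatrix}.$$ (If $a>\kappa$ and $b>\sigma$, they have degree $n$ and are orthogonal with respect to $\sum_{x=0}^N(a-\kappa+1+x)_\kappa(N+b-\sigma+1-x)_\sigma\binom{a-\kappa-1+x}{x}\binom{N+b-\sigma-1-x}{N-x}\delta_x$.) *)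

(* Defs.v *)
From mathcomp Require Import all_boot all_order all_algebra.

Set Implicit Arguments.
Unset Strict Implicit.
Unset Printing Implicit Defensive.

Import GRing.Theory.
Local Open Scope ring_scope.

(* (y)_j, over any ring: it is also used with y = - 'X. *)
Definition pochhammer (A : pzRingType) (y : A) (j : nat) : A :=
  \prod_(i < j) (y + i%:R).

(* Binomial coefficient with arbitrary upper entry. *)
Definition gbinom (F : fieldType) (y : F) (j : nat) : F :=
  (\prod_(i < j) (y - i%:R)) / j`!%:R.

Definition mx_of_rows (A : nmodType) (n : nat) (rows : seq (seq A)) : 'M[A]_n :=
  \matrix_(i, j) nth 0 (nth [::] rows i) j.

Definition jacobi (F : fieldType) (al be : F) (n : nat) : {poly F} :=
  2 ^- n *: \sum_(j < n.+1)
    (gbinom (n%:R + al) j * gbinom (n%:R + be) (n - j)) *: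
      (('X - 1) ^+ (n - j) * ('X + 1) ^+ j).

(* Krall Jacobi polynomials with u = oo; only meaningful for 1 <= n. *)
Definition krall_jacobi (F : fieldType) (al : F) (k n : nat) : {poly F} :=
  jacobi al k%:R n + ((n + k)%:R / n%:R) *: jacobi al k%:R n.-1.

(* T_s^k(y); since k is a positive integer, Gamma(k) = (k - 1)!. *)
Definition krall_T (F : fieldType) (k s : nat) (y : F) : F :=
  2 ^+ (k + s) * k.-1`!%:R / pochhammer (y + s%:R + 1) k.

(* Krall Jacobi polynomials with u = v = oo. *)
Definition krall_jacobi2 (F : fieldType) (k s n : nat) : {poly F} :=
  match n with
  | 0 => 1
  | 1 =>
      let Tk := krall_T k s (-1 : F) / pochhammer 2 k in
      let Ts := krall_T s k (-1 : F) / pochhammer 2 s in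
      \det (mx_of_rows 2 [:: [:: 1 / (1 + k%:R); Tk];
                             [:: - 1 / (1 + s%:R); Ts]])
        *: jacobi k%:R s%:R 1
      - (\det (mx_of_rows 2 [:: [:: 1; Tk];
                                [:: 1; Ts]]))%:P
  | m.+2 =>
      let nu : F := n%:R in
      \det (mx_of_rows 3
        [:: [:: jacobi k%:R s%:R n; jacobi k%:R s%:R m.+1; jacobi k%:R s%:R m];
            [:: 1; (nu / (nu + k%:R))%:P;
                (pochhammer (nu - 1) 2 / pochhammer (nu + k%:R - 1) 2)%:P];
            [:: 1; (- nu / (nu + s%:R))%:P;
                (pochhammer (nu - 1) 2 / pochhammer (nu + s%:R - 1) 2)%:P]])
  end.

(* Hahn polynomials, with h_n = 0 for n < 0; only meaningful for n <= N. *)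
Definition hahn (F : fieldType) (a b : F) (N : nat) (n : int) : {poly F} :=
  match n with
  | Posz m =>
      m`!%:R^-1 *: \sum_(j < m.+1)
        (pochhammer (- m%:R) j * pochhammer (m%:R + a + b + 1) j
           * pochhammer (a + j%:R + 1) (m - j)
           / (pochhammer (- N%:R) j * j`!%:R)) *: pochhammer (- 'X) j
  | Negz _ => 0
  end.

Definition lambda_poly (F : fieldType) (w : F) (j : nat) : {poly F} :=
  \prod_(i < j) ('X - (i%:R * (w + i%:R + 1))%:P).

Definition theta (F : fieldType) (w x : F) : F := x * (x + w + 1).

Definition dual_hahn (F : fieldType) (A B M : F) (n : nat) : {poly F} :=
  \sum_(j < n.+1)
    (pochhammer (- n%:R) j * pochhammer (- M + j%:R) (n - j)
       * pochhammer (A + j%:R + 1) (n - j)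
       / ((-1) ^+ j * j`!%:R)) *: lambda_poly (A + B) j.

(* S_k^{a,b,N}(y) *)
Definition krall_S (F : fieldType) (k : nat) (a b : F) (N : nat) (y : F) : F :=
  (dual_hahn (- b) (- a) (a + b + N%:R) k).[theta (- a - b) (- y - 1)].

(* h_n^{k,s;a,b,N}; only meaningful for n <= N. *)
Definition krall_hahn (F : fieldType) (k s : nat) (a b : F) (N n : nat) :
    {poly F} :=
  let nu : F := n%:R in
  let d2 := pochhammer (nu + a + b - 1) 2 in
  let d1 := nu + a + b - 1 in
  \det (mx_of_rows 3
    [:: [:: hahn a b N n%:Z; hahn a b N (n%:Z - 1); hahn a b N (n%:Z - 2)];
        [:: (pochhammer (nu + b - 1) 2 / d2 * krall_S k b a N nu)%:P;
            ((nu + b - 1) / d1 * krall_S k b a N (nu - 1))%:P;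
            (krall_S k b a N (nu - 2))%:P];
        [:: (pochhammer (nu + a - 1) 2 / d2 * krall_S s a b N nu)%:P;
            (- ((nu + a - 1) / d1) * krall_S s a b N (nu - 1))%:P;
            (krall_S s a b N (nu - 2))%:P]]).

(* Lambda_s^{b,a}(n), for b an integer with 1 <= b <= s. *)
Definition Lambda (F : fieldType) (s b : nat) (a : F) (n : nat) : F :=
  (-1) ^+ (s + b) * pochhammer (b%:R + 1) (s - b)
    * pochhammer (n%:R + a - 1) b * pochhammer (n%:R + 1) b.

(* Main.v *)
Require Import Defs.
From mathcomp Require Import all_boot all_order all_algebra.
From mathcomp Require Import all_classical all_reals all_analysis.
From mathcomp Require Import ring zify.

(* Divide the second and third rows of the determinant by the powers of [N]
   governing [S_kappa] and [S_sigma] and let [N] go to infinity.  The Hahn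
   polynomials tend to Jacobi polynomials (compared through the 2F1 expansion).
   In the sum defining [S_k^{a,b,N}] the [j]-th term has order [N^(k - j)] and
   carries the factor [(1 - b + j)_{k - j}], which vanishes for [j < b] when [b]
   is one of [1, ..., k]; so [S_k / N^k -> (b - k)_k] in general, whereas
   [S_k / N^(k - b)] has a limit polynomial in [n] in the exceptional case, which
   is where [Lambda] comes from.  The limit determinants are then collapsed with
   the contiguous relations lowering one parameter of a Jacobi polynomial.
   When both parameters are exceptional and [n <= 1], the determinant is
   identically zero, which the degree assumption excludes. *)

Import Order.TTheory GRing.Theory Num.Theory.
Import numFieldNormedType.Exports.
Local Open Scope classical_set_scope.
Local Open Scope ring_scope.

(** * Pochhammer symbols and generalized binomials *)

Lemma pochhammer_recl (A : pzRingType) (y : A) j :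
  pochhammer y j.+1 = y * pochhammer (y + 1) j.
Proof.
rewrite /pochhammer big_ord_recl addr0; congr (_ * _).
by apply: eq_bigr => i _; rewrite /= /bump add1n -addrA -natr1 [1 + _]addrC.
Qed.

Lemma pochhammer_recr (A : pzRingType) (y : A) j :
  pochhammer y j.+1 = pochhammer y j * (y + j%:R).
Proof. by rewrite /pochhammer big_ord_recr. Qed.

Lemma pochhammer0 (A : pzRingType) (y : A) : pochhammer y 0 = 1.
Proof. by rewrite /pochhammer big_ord0. Qed.

Lemma pochhammer2 (A : pzRingType) (y : A) : pochhammer y 2 = y * (y + 1).
Proof. by rewrite !pochhammer_recr pochhammer0 addr0 mul1r. Qed.

Lemma pochhammerN (F : comPzRingType) (y : F) j :
  pochhammer (- y) j = (-1) ^+ j * pochhammer (y - j%:R + 1) j.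
Proof.
elim: j y => [|j IH] y; first by rewrite !pochhammer0 mul1r.
rewrite pochhammer_recl (_ : - y + 1 = - (y - 1)) ?IH; last ring.
rewrite pochhammer_recr exprS.
rewrite (_ : y - 1 - j%:R + 1 = y - j.+1%:R + 1); last by rewrite -natr1; ring.
by rewrite -natr1; ring.
Qed.

Lemma pochhammerNn (F : numFieldType) n j : (j <= n)%N ->
  pochhammer (- n%:R : F) j = (-1) ^+ j * n`!%:R / (n - j)`!%:R.
Proof.
elim: j => [|j IH] jn.
  by rewrite pochhammer0 subn0 mul1r divff // pnatr_eq0 -lt0n fact_gt0.
rewrite pochhammer_recr IH 1?ltnW // (_ : (n - j)%N = (n - j.+1).+1); last lia.
have f0 : (n - j.+1)`!%:R != 0 :> F by rewrite pnatr_eq0 -lt0n fact_gt0.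
have n0 : (n - j.+1)%:R + 1 != 0 :> F by rewrite natr1 pnatr_eq0.
rewrite factS natrM -natr1 natrB // -[j.+1%:R]natr1 exprS in n0 *.
by field; rewrite f0 n0.
Qed.

Lemma gbinomS (F : numFieldType) (y : F) j :
  j.+1%:R * gbinom y j.+1 = (y - j%:R) * gbinom y j.
Proof.
rewrite /gbinom big_ord_recr /= factS natrM.
have f0 : j`!%:R != 0 :> F by rewrite pnatr_eq0 -lt0n fact_gt0.
have n0 : 1 + j%:R != 0 :> F by rewrite nat1r pnatr_eq0.
by field; rewrite f0 n0.
Qed.

Lemma gbinom0 (F : numFieldType) (y : F) : gbinom y 0 = 1.
Proof. by rewrite /gbinom big_ord0 divr1. Qed.

Lemma gbinom_Vandermonde (F : numFieldType) (y z : F) n :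
  \sum_(j < n.+1) gbinom y j * gbinom z (n - j) = gbinom (y + z) n.
Proof.
elim: n => [|n IH]; first by rewrite big_ord1 !gbinom0 mul1r.
have n0 : n.+1%:R != 0 :> F by rewrite pnatr_eq0.
apply: (mulfI n0); rewrite gbinomS -IH !mulr_sumr.
(* The factor [n + 1] is split as [i + (n + 1 - i)]. Each half is absorbed into its binomial by
   [gbinomS], which lowers that index and brings back the sum for [n]. *)
have -> : \sum_(i < n.+2) n.+1%:R * (gbinom y i * gbinom z (n.+1 - i)) =
  \sum_(i < n.+2) (i%:R * gbinom y i) * gbinom z (n.+1 - i) +
  \sum_(i < n.+2) gbinom y i * ((n.+1 - i)%:R * gbinom z (n.+1 - i)).
  rewrite -big_split; apply: eq_bigr => i _ /=.
  by rewrite natrB; [ring | rewrite -ltnS].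
rewrite big_ord_recl [X in _ + X]big_ord_recr /= subnn !mul0r mulr0 add0r addr0.
rewrite -big_split; apply: eq_bigr => i _ /=.
rewrite /bump add1n gbinomS subSS subSn -1?ltnS // gbinomS.
by rewrite natrB -1?ltnS //; ring.
Qed.

Lemma gbinom_bin (F : numFieldType) (y : F) i d :
  gbinom y (i + d) * 'C(i + d, i)%:R = gbinom y i * gbinom (y - i%:R) d.
Proof.
have f0 k : k`!%:R != 0 :> F by rewrite pnatr_eq0 -lt0n fact_gt0.
have := bin_fact (leq_addr d i); rewrite addKn => /(congr1 (fun k => k%:R : F)).
rewrite !natrM /gbinom big_split_ord /= => <-.
have b0 : 'C(i + d, i)%:R != 0 :> F by rewrite pnatr_eq0 -lt0n bin_gt0 leq_addr.
rewrite (eq_bigr (fun k : 'I_d => y - i%:R - k%:R)).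
  by field; rewrite !f0 b0.
by move=> k _; rewrite natrD; ring.
Qed.

Lemma gbinom_pochhammer (F : numFieldType) (y : F) m :
  gbinom (y + m%:R) m = pochhammer (y + 1) m / m`!%:R.
Proof.
rewrite /gbinom /pochhammer; congr (_ / _).
rewrite (reindex_inj rev_ord_inj); apply: eq_bigr => i _ /=.
by rewrite natrB // -natr1; ring.
Qed.

Lemma sum_triangle (V : nmodType) n (G : nat -> nat -> V) :
  \sum_(j < n.+1) \sum_(i < j.+1) G i j =
  \sum_(i < n.+1) \sum_(d < (n - i).+1) G i (i + d)%N.
Proof.
transitivity (\sum_(j < n.+1) \sum_(i < n.+1 | (i <= j)%N) G i j).
  apply: eq_bigr => j _.
  by rewrite (big_ord_widen n.+1 (fun i => G i j)) // ltn_ord.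
rewrite (exchange_big_dep xpredT) //=; apply: eq_bigr => i _.
rewrite big_mkcond /=.
rewrite -(big_mkord xpredT (fun j => if (i <= j)%N then G i j else 0)).
rewrite (big_cat_nat (n := i)) //=; last exact: ltnW.
rewrite big_nat big1 ?add0r; last first.
  by move=> j /andP[_]; rewrite ltnNge => /negbTE->.
rewrite -{1}[i : nat]add0n big_addn subSn -1?ltnS // big_mkord.
by apply: eq_bigr => d _; rewrite leq_addl addnC.
Qed.

(** * Jacobi polynomials: hypergeometric form, reflection, contiguous relations *)

Lemma horner_Xsub1 (R : comNzRingType) (x : R) : ('X - 1).[x] = x - 1.
Proof. by rewrite !hornerE. Qed.

Lemma horner_Xadd1 (R : comNzRingType) (x : R) : ('X + 1).[x] = x + 1.
Proof. by rewrite !hornerE. Qed.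

(** The coefficient of [((1 - x) / 2) ^ j] in (al+1)_n / n! times 2F1(-n, n+al+be+1; al+1; (1-x)/2).
    The quotient (al+1)_n / (al+1)_j is stored as a single Pochhammer symbol, so the formula stays
    valid when [al] is a negative integer. *)
Definition jacobi_hyper {F : fieldType} (al be : F) (n j : nat) : F :=
  (-1) ^+ j * pochhammer (n%:R + al + be + 1) j
    * pochhammer (al + j%:R + 1) (n - j) / (j`!%:R * (n - j)`!%:R).

Lemma jacobi_hyperE (F : numFieldType) (al be x : F) n :
  (jacobi al be n).[x] =
  \sum_(j < n.+1) jacobi_hyper al be n j * ((1 - x) / 2) ^+ j.
Proof.
rewrite /jacobi hornerZ horner_sum; set y := (1 - x) / 2.
have two0 : 2 != 0 :> F by rewrite pnatr_eq0.
have xE : x = 1 - 2 * y by rewrite /y; field.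
rewrite mulr_sumr.
(* With [x - 1 = -2y] and [x + 1 = 2(1 - y)], the powers of 2 cancel. The binomial theorem for
   [(1 - y) ^ j] gives terms in which the power of [y] depends on [i] alone. After exchanging the
   sums, the inner one is a Vandermonde convolution. *)
pose G i j := gbinom (n%:R + al) i * gbinom (n%:R + al - i%:R) (j - i)
  * gbinom (n%:R + be) (n - j) * (- y) ^+ (n - i).
transitivity (\sum_(j < n.+1) \sum_(i < j.+1) G i j).
  apply: eq_bigr => j _.
  rewrite hornerZ hornerM !horner_exp horner_Xsub1 horner_Xadd1.
  have -> : x - 1 = 2 * - y by rewrite xE; ring.
  have -> : x + 1 = 2 * (- y + 1) by rewrite xE; ring.
  rewrite !exprMn (exprDn (- y)).
  have jn : (j <= n)%N by rewrite -ltnS.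
  transitivity (gbinom (n%:R + al) j * gbinom (n%:R + be) (n - j) *
    ((- y) ^+ (n - j) * \sum_(i < j.+1) (- y) ^+ (j - i) * 1 ^+ i *+ 'C(j, i))).
    have t : 2 ^+ n = 2 ^+ (n - j) * 2 ^+ j :> F by rewrite -exprD subnK.
    by rewrite t; field; rewrite !expf_neq0.
  rewrite !mulr_sumr; apply: eq_bigr => i _.
  have ij : (i <= j)%N by rewrite -ltnS.
  rewrite /G expr1n mulr1 -gbinom_bin subnKC // -mulr_natr.
  have -> : (n - i)%N = (n - j + (j - i))%N by lia.
  by rewrite exprD; ring.
rewrite sum_triangle [RHS](reindex_inj rev_ord_inj) /=; apply: eq_bigr => i _.
have ni : (i <= n)%N by rewrite -ltnS.
rewrite subSS /G.
transitivity (gbinom (n%:R + al) i * (- y) ^+ (n - i) *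
    gbinom (n%:R + al + be + (n - i)%:R) (n - i)).
  rewrite (_ : n%:R + al + be + (n - i)%:R =
    (n%:R + al - i%:R) + (n%:R + be)); last first.
    by rewrite natrB //; ring.
  rewrite -(gbinom_Vandermonde _ (n%:R + al - i%:R)) mulr_sumr.
  apply: eq_bigr => d _.
  by rewrite addKn subnDA; ring.
rewrite gbinom_pochhammer /jacobi_hyper subKn //.
rewrite (_ : n%:R + al = (n - i)%:R + al + i%:R); last by rewrite natrB //; ring.
rewrite gbinom_pochhammer exprNn.
rewrite (_ : (n - i)%:R + al + i%:R = n%:R + al); last by rewrite natrB //; ring.
have f0 k : k`!%:R != 0 :> F by rewrite pnatr_eq0 -lt0n fact_gt0.
rewrite [(n - i)%:R + al]addrC.
by field; rewrite !f0.
Qed.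

Lemma jacobi_sym (F : numFieldType) (al be x : F) n :
  (jacobi al be n).[- x] = (-1) ^+ n * (jacobi be al n).[x].
Proof.
rewrite /jacobi !hornerZ !horner_sum mulrCA; congr (_ * _).
rewrite (reindex_inj rev_ord_inj) /= mulr_sumr; apply: eq_bigr => i _.
have ni : (i <= n)%N by rewrite -ltnS.
rewrite subSS subKn // !hornerZ !hornerM !horner_exp !horner_Xsub1 !horner_Xadd1.
have -> : - x - 1 = - (x + 1) by ring.
have -> : - x + 1 = - (x - 1) by ring.
rewrite (exprNn (x + 1)) (exprNn (x - 1)).
rewrite -[X in (-1) ^+ X * (_ * _)](subnK ni) exprD.
ring.
Qed.

(* With the value 0 for [n < 0], as for [hahn], the two contiguous relations hold
   for every integer [n]. *)
Definition jacobi_int {F : fieldType} (al be : F) (n : int) : {poly F} :=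
  if n is Posz m then jacobi al be m else 0.

(** The coefficients of each power of [(1 - x) / 2] are compared in the hypergeometric expansions.
    The top power is split off because the term of degree [n - 1] does not contribute to it. *)
Lemma jacobi_int_pred_left (F : numFieldType) (al be x : F) (n : int) :
  (2 * n%:~R + al + be) * (jacobi_int (al - 1) be n).[x] =
  (n%:~R + al + be) * (jacobi_int al be n).[x]
  - (n%:~R + be) * (jacobi_int al be (n - 1)).[x].
Proof.
case: n => [n|n]; last first.
  by rewrite (_ : Negz n - 1 = Negz n.+1) /= ?horner0; [ring | lia].
have f0 k : k`!%:R != 0 :> F by rewrite pnatr_eq0 -lt0n fact_gt0.
have s0 k : 1 + k%:R != 0 :> F by rewrite nat1r pnatr_eq0.
case: n => [|n].
  rewrite /= horner0 !jacobi_hyperE !big_ord1 /jacobi_hyper !pochhammer0 /=; ring.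
rewrite (_ : n.+1%:Z - 1 = n) /=; last lia.
rewrite !jacobi_hyperE !mulr_sumr -pmulrn [X in _ = X - _]big_ord_recr /=.
rewrite big_ord_recr /= [RHS]addrAC -sumrB; congr (_ + _); last first.
  rewrite /jacobi_hyper subnn !pochhammer0.
  rewrite (_ : n.+1%:R + (al - 1) + be + 1 = n.+1%:R + al + be); last ring.
  rewrite pochhammer_recl [pochhammer (n.+1%:R + al + be + 1) n.+1]pochhammer_recr.
  by rewrite factS natrM; field; rewrite !f0 s0.
apply: eq_bigr => i _.
have ni : (i <= n)%N by rewrite -ltnS.
rewrite /jacobi_hyper subSn //.
rewrite (_ : n.+1%:R + (al - 1) + be + 1 = n.+1%:R + al + be); last ring.
rewrite (_ : n%:R + al + be + 1 = n.+1%:R + al + be); last by rewrite -natr1; ring.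
(* Lowering [al] shifts the base of this Pochhammer symbol by one. Both sides are the same product
   of [i + 1] factors, which relates the two bases. *)
have e : pochhammer (n.+1%:R + al + be) i * (n.+1%:R + al + be + i%:R) =
  (n.+1%:R + al + be) * pochhammer (n.+1%:R + al + be + 1) i.
  by rewrite -pochhammer_recl -pochhammer_recr.
rewrite (_ : al - 1 + i%:R + 1 = al + i%:R); last ring.
rewrite pochhammer_recl pochhammer_recr factS natrM.
have h c s p t d z : c * (s * p * t / d * z) = s * (c * p) * t / d * z :> F.
  by ring.
rewrite [in X in _ = X - _]h -e -[(n - i).+1%:R]natr1 natrB // -[n.+1%:R]natr1.
have n0 : n%:R - i%:R + 1 != 0 :> F by rewrite -natrB // natr1 pnatr_eq0.
by field; rewrite !f0 n0.
Qed.

(** The reflection [x -> -x] swaps the two parameters, so this follows from [jacobi_int_pred_left].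
    The sign of the last term flips because its degree has the other parity. *)
Lemma jacobi_int_pred_right (F : numFieldType) (al be x : F) (n : int) :
  (2 * n%:~R + al + be) * (jacobi_int al (be - 1) n).[x] =
  (n%:~R + al + be) * (jacobi_int al be n).[x]
  + (n%:~R + al) * (jacobi_int al be (n - 1)).[x].
Proof.
case: n => [n|n]; last first.
  by rewrite (_ : Negz n - 1 = Negz n.+1) /= ?horner0; [ring | lia].
have refl m c d :
    (jacobi_int c d (Posz m)).[x] = (-1) ^+ m * (jacobi_int d c m).[- x].
  by rewrite /= jacobi_sym mulrA -expr2 sqrr_sign mul1r.
have := jacobi_int_pred_left F be al (- x) n.
case: n => [|n].
  rewrite !refl /= !horner0 !expr0 !mul1r => e.
  by rewrite (addrAC _ al be) e; ring.
rewrite (_ : n.+1%:Z - 1 = n) ?refl => [e|]; last lia.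
rewrite [LHS]mulrCA (addrAC _ al be) e exprS; ring.
Qed.

(** The cofactor expansion along the first row, kept explicit so that limits and evaluation pass
    through sums and products and the identities are within reach of [ring] and [field]. *)
Definition det3 {A : pzRingType} (u0 u1 u2 v0 v1 v2 w0 w1 w2 : A) : A :=
  u0 * (v1 * w2 - v2 * w1) - u1 * (v0 * w2 - v2 * w0) + u2 * (v0 * w1 - v1 * w0).

Lemma det_mx_of_rows3 (A : comNzRingType) (u0 u1 u2 v0 v1 v2 w0 w1 w2 : A) :
  \det (mx_of_rows 3 [:: [:: u0; u1; u2]; [:: v0; v1; v2]; [:: w0; w1; w2]]) =
  det3 u0 u1 u2 v0 v1 v2 w0 w1 w2.
Proof.
rewrite (expand_det_row _ ord0) !big_ord_recl big_ord0 /cofactor.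
rewrite !(expand_det_row _ ord0) !big_ord_recl !big_ord0 /cofactor !det_mx11.
by rewrite !mxE /det3 /bump /=; ring.
Qed.

(** * The limit from Hahn to Jacobi polynomials *)

Lemma natV_cvg (R : realType) : (N%:R^-1 : R) @[N --> \oo] --> (0 : R).
Proof.
apply/gtr0_cvgV0; last exact: cvgr_idn.
by exists 1%N => // N /= ?; rewrite ltr0n.
Qed.

Lemma near_natr_neq0 (R : realType) : \forall N \near \oo, (N%:R : R) != 0.
Proof. by exists 1%N => // N /= ?; rewrite pnatr_eq0 -lt0n. Qed.

Lemma pochhammer_linear_cvg (R : realType) (z c : R) j :
  pochhammer (z * N%:R + c) j / N%:R ^+ j @[N --> \oo] --> z ^+ j.
Proof.
elim: j => [|j IH].
  by under eq_cvg do rewrite pochhammer0 expr0 divr1; exact: cvg_cst.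
under eq_cvg do rewrite pochhammer_recr exprSr invfM mulrACA.
rewrite exprSr; apply: cvgM => //.
rewrite -[z in X in _ --> X]addr0 -[in X in _ --> X](mulr0 (c + j%:R)).
apply: cvg_trans (cvgD (cvg_cst z) (cvgM (cvg_cst (c + j%:R)) (natV_cvg R))).
apply: near_eq_cvg; near=> N.
have N0 : N%:R != 0 :> R by near: N; exact: near_natr_neq0.
by rewrite addrfctE /=; field.
Unshelve. all: by end_near. Qed.

Lemma pochhammer_ratio_cvg (R : realType) (z : R) j :
  pochhammer (- (z * N%:R)) j / pochhammer (- N%:R) j @[N --> \oo] --> z ^+ j.
Proof.
have m1 : (-1) ^+ j != 0 :> R by rewrite expf_neq0 // oppr_eq0 oner_eq0.
rewrite (_ : z ^+ j = (- z) ^+ j * ((-1) ^+ j)^-1); last first.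
  by rewrite (exprNn z) mulrAC divff ?mul1r.
apply: cvg_trans (cvgM (pochhammer_linear_cvg R (- z) 0 j)
  (cvgV m1 (pochhammer_linear_cvg R (- 1) 0 j))).
apply: near_eq_cvg; near=> N.
have N0 : N%:R ^+ j != 0 :> R.
  by apply: expf_neq0; near: N; exact: near_natr_neq0.
by rewrite /= !addr0 mulN1r mulNr invfM invrK mulrCA divfK // mulrC.
Unshelve. all: by end_near. Qed.

Lemma horner_pochhammerNX (F : fieldType) (y : F) j :
  (pochhammer (- 'X) j).[y] = pochhammer (- y) j.
Proof.
by rewrite horner_prod; apply: eq_bigr => i _; rewrite -polyC_natr !hornerE.
Qed.

Lemma hahn_cvg (R : realType) (a b x : R) (n : int) :
  (hahn a b N n).[(1 - x) * N%:R / 2] @[N --> \oo] --> (jacobi_int a b n).[x].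
Proof.
case: n => n /=; last first.
  by under eq_cvg do rewrite horner0; rewrite horner0; exact: cvg_cst.
rewrite jacobi_hyperE.
under eq_cvg do rewrite hornerZ horner_sum mulr_sumr.
apply: (cvg_big add_continuous) => j _.
have jn : (j <= n)%N by rewrite -ltnS.
have f0 k : k`!%:R != 0 :> R by rewrite pnatr_eq0 -lt0n fact_gt0.
(* The [j]-th Hahn term is the Jacobi coefficient times the ratio (-X)_j / (-N)_j, the only part
   that depends on [N]. *)
apply: cvg_trans (cvgM (cvg_cst (jacobi_hyper a b n j))
  (pochhammer_ratio_cvg R ((1 - x) / 2) j)).
apply: near_eq_cvg; near=> N.
rewrite /= hornerZ horner_pochhammerNX (pochhammerNn _ n) // /jacobi_hyper.
rewrite (_ : (1 - x) * N%:R / 2 = (1 - x) / 2 * N%:R); last by ring.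
(* The inverse is generalized: (-N)_j vanishes when [N < j], and the identity does not depend on its
   value. *)
rewrite (invfM (pochhammer (- N%:R) j)); move: (pochhammer (- N%:R) j)^-1 => u.
by field; rewrite !f0.
Unshelve. all: by end_near. Qed.

(** * Asymptotics of the dual Hahn values [krall_S] *)

(** Factor by factor, [y (y + w + 1) - i (w + i + 1) = (y - i) (y + w + 1 + i)]. *)
Lemma lambda_poly_theta (F : fieldType) (w y : F) j :
  (lambda_poly w j).[theta w y] =
  (-1) ^+ j * pochhammer (- y) j * pochhammer (y + w + 1) j.
Proof.
rewrite horner_prod /pochhammer -[X in (-1) ^+ X]card_ord -prodr_const -!big_split.
by apply: eq_bigr => i _; rewrite !hornerE /theta /=; ring.
Qed.

(** Here [m] is the first index whose term is not forced to vanish. That term has order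
    [N ^ (k - m)] and the later ones have lower order, so it alone gives the limit. The generic case
    is [m = 0]; the exceptional one takes [m] to be the integer value of [b]. *)
Lemma krall_S_cvg (R : realType) (k m : nat) (a b y : R) : (m <= k)%N ->
  (forall j, (j < m)%N -> pochhammer (- b + j%:R + 1) (k - j) = 0) ->
  krall_S k a b N y / N%:R ^+ (k - m) @[N --> \oo] -->
  pochhammer (- k%:R) m * (-1) ^+ (k - m) * pochhammer (- b + m%:R + 1) (k - m)
    / ((-1) ^+ m * m`!%:R)
    * (lambda_poly (- b - a) m).[theta (- a - b) (- y - 1)].
Proof.
move=> mk van; rewrite /krall_S /dual_hahn.
set L := fun j => (lambda_poly (- b - a) j).[theta (- a - b) (- y - 1)].
pose C j := pochhammer (- k%:R) j * pochhammer (- b + j%:R + 1) (k - j)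
    / ((-1) ^+ j * j`!%:R) * L j.
(* The limit is written as a sum with a single nonzero term, so that convergence can be checked term
   by term. *)
rewrite [X in _ --> X](_ : _ =
    \sum_(j < k.+1) if j == m :> nat then C m * (-1) ^+ (k - m) else 0); last first.
  rewrite -big_mkcond /= (big_pred1 (Ordinal (mk : (m < k.+1)%N))) => [|j].
    by rewrite /C /L; ring.
  by rewrite /= -val_eqE.
under eq_cvg do rewrite horner_sum mulr_suml.
apply: (cvg_big add_continuous) => j _.
have jk : (j <= k)%N by rewrite -ltnS.
have [jm|mj|->] := ltngtP j m; last 1 first.
- apply: cvg_trans (cvgM (cvg_cst (C m))
    (pochhammer_linear_cvg R (- 1) (- (a + b) + m%:R) (k - m))).
  apply: near_eq_cvg; near=> N.
  rewrite /= hornerZ /C /L (_ : - (a + b + N%:R) + m%:R =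
      -1 * N%:R + (- (a + b) + m%:R)); last ring.
  ring.
- under eq_cvg do rewrite hornerZ van // mulr0 !mul0r.
  exact: cvg_cst.
(* For [j > m] a factor [N ^- (j - m)] is left over and tends to 0. *)
rewrite -(mulr0 (C j * (-1) ^+ (k - j))).
have lim0 : (N%:R ^- (j - m) : R) @[N --> \oo] --> (0 : R).
  rewrite (_ : (j - m)%N = (j - m.+1).+1); last lia.
  elim: (j - m.+1)%N => [|d IH]; first exact: natV_cvg.
  rewrite -(mul0r 0); under eq_cvg do rewrite exprS invfM.
  exact: cvgM (natV_cvg R) IH.
apply: cvg_trans (cvgM (cvgM (cvg_cst (C j))
    (pochhammer_linear_cvg R (- 1) (- (a + b) + j%:R) (k - j))) lim0).
apply: near_eq_cvg; near=> N.
rewrite /= hornerZ /C /L (_ : - (a + b + N%:R) + j%:R =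
    -1 * N%:R + (- (a + b) + j%:R)); last ring.
rewrite (_ : (k - m)%N = (k - j + (j - m))%N); last lia.
by rewrite exprD invfM; ring.
Unshelve. all: by end_near. Qed.

Lemma pochhammer_eq0 (A : comPzRingType) (y : A) i j :
  (i < j)%N -> y + i%:R = 0 -> pochhammer y j = 0.
Proof.
by move=> ij yi0; rewrite /pochhammer (bigD1 (Ordinal ij)) //= yi0 mul0r.
Qed.

Lemma pochhammer_shift (A : comPzRingType) (y : A) j :
  y * pochhammer (y + 1) j = pochhammer y j * (y + j%:R).
Proof. by rewrite -pochhammer_recl pochhammer_recr. Qed.

Lemma pochhammer_natr (F : pzRingType) q d :
  pochhammer (q%:R + 1 : F) d * q`!%:R = (q + d)`!%:R.
Proof.
elim: d => [|d IH]; first by rewrite pochhammer0 mul1r addn0.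
rewrite pochhammer_recr -addrA nat1r -natrD addnS -addSn -mulrA.
by rewrite (commr_nat _ q`!) mulrA IH -natrM factS mulnC addSn.
Qed.

Lemma krall_S_cvg_generic (R : realType) (k : nat) (a b y : R) :
  krall_S k a b N y / N%:R ^+ k @[N --> \oo] --> pochhammer (b - k%:R) k.
Proof.
have := krall_S_cvg R k 0 a b y (leq0n k); rewrite subn0.
move=> /(_ _)/cvg_trans; apply=> //.
rewrite pochhammer0 /lambda_poly big_ord0 hornerC fact0 expr0.
rewrite (_ : - b + 0%:R + 1 = - (b - 1)); last by ring.
rewrite pochhammerN (_ : b - 1 - k%:R + 1 = b - k%:R); last by ring.
by rewrite mul1r mulrA -expr2 sqrr_sign !mul1r divr1 mulr1.
Qed.

Lemma pochhammer_krall_S_eq0 (F : fieldType) k q j : (q <= k)%N -> (j < q)%N ->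
  pochhammer (- q%:R + j%:R + 1 : F) (k - j) = 0.
Proof.
(* The zero factor has index [q - j - 1], which is below [k - j] because [q <= k]. *)
move=> qk jq; apply: (@pochhammer_eq0 _ _ (q - j.+1)); first lia.
by rewrite natrB // -natr1; ring.
Qed.

(** Only the term [j = q] survives. Its constant is k!/q! = (q+1)_{k-q} up to sign, and the value of
    [lambda_poly] at [theta] splits into the two Pochhammer symbols in [y]. *)
Lemma krall_S_cvg_nat (R : realType) (k q : nat) (a y : R) : (q <= k)%N ->
  krall_S k a q%:R N y / N%:R ^+ (k - q) @[N --> \oo] -->
  (-1) ^+ (k + q) * pochhammer (q%:R + 1) (k - q)
    * (pochhammer (y + 1) q * pochhammer (y + a + 1) q).
Proof.
move=> qk.
rewrite [X in _ --> X](_ : _ = pochhammer (- k%:R) q * (-1) ^+ (k - q) *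
    pochhammer (- q%:R + q%:R + 1) (k - q) / ((-1) ^+ q * q`!%:R)
    * (lambda_poly (- q%:R - a) q).[theta (- a - q%:R) (- y - 1)]).
  by apply: krall_S_cvg => // j; apply: pochhammer_krall_S_eq0.
have f0 j : j`!%:R != 0 :> R by rewrite pnatr_eq0 -lt0n fact_gt0.
rewrite (addrC (- a)) lambda_poly_theta pochhammerNn //.
have := pochhammer_natr R 0 (k - q); rewrite add0n mulr1 add0r => p1.
rewrite addNr add0r p1.
rewrite (_ : - (- y - 1) = y + 1); last ring.
rewrite (_ : - y - 1 + _ + 1 = - (y + a + q%:R)); last ring.
rewrite pochhammerN addrK.
have := pochhammer_natr R q (k - q); rewrite subnKC // => <-.
have -> : (-1) ^+ (k + q) = (-1) ^+ (k - q) :> R.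
  rewrite -[in LHS](subnK qk) -addnA addnn exprD -mul2n exprM sqrrN.
  by rewrite !expr1n mulr1.
rewrite !(mulrA _ ((-1) ^+ q)).
have s2 : (-1) ^+ q * (-1) ^+ q = 1 :> R by rewrite -expr2 sqrr_sign.
have s0 : (-1) ^+ q != 0 :> R by rewrite signr_eq0.
by field: s2; rewrite !f0 s0.
Qed.

(** At [y = -1] the dual Hahn argument is 0. Terms with [j < q] vanish through their coefficient,
    and those with [j >= q > 0] because [lambda_poly] has the factor ['X]. *)
Lemma krall_S_predr0 (F : fieldType) k q (a : F) N : (0 < q <= k)%N ->
  krall_S k a q%:R N (- 1) = 0.
Proof.
move=> /andP[q0 qk]; rewrite /krall_S /dual_hahn horner_sum big1 // => j _.
rewrite hornerZ; have [jq|qj] := ltnP j q.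
  by rewrite pochhammer_krall_S_eq0 // mulr0 !mul0r.
rewrite (addrC (- q%:R) (- a)) lambda_poly_theta.
rewrite (@pochhammer_eq0 _ (- (- -1 - 1)) 0) ?mulr0 ?mul0r ?mulr0 //.
  exact: leq_trans qj.
by ring.
Qed.

Lemma natr_add_pred_neq0 (F : numFieldType) n q : (0 < n)%N -> (0 < q)%N ->
  n%:R + q%:R - 1 != 0 :> F.
Proof.
move=> n0 q0.
by rewrite -(prednK n0) -natr1 addrAC addrK -natrD pnatr_eq0; lia.
Qed.

(** In the exceptional case the limits of a row share the factor [Lambda]; what remains is a row of
    the determinant [krall_jacobi2], up to the sign of the middle entry. The equation for [d] lets
    both rows use the lemma, although they order [a] and [b] differently. *)
Lemma krall_S_limit_row (F : numFieldType) (k q n : nat) (a d : F) :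
  let c := (-1) ^+ (k + q) * pochhammer (q%:R + 1) (k - q) in
  let t y := c * (pochhammer (y + 1) q * pochhammer (y + a + 1) q) in
  let nu : F := n%:R in
  (0 < n)%N -> (0 < q)%N ->
  d = nu + a + q%:R - 1 -> d != 0 -> nu + a + q%:R != 0 ->
  [/\ pochhammer (nu + a - 1) 2 / pochhammer d 2 * t nu = Lambda k q a n,
      (nu + a - 1) / d * t (nu - 1) = Lambda k q a n * (nu / (nu + q%:R)) &
      t (nu - 2) = Lambda k q a n
        * (pochhammer (nu - 1) 2 / pochhammer (nu + q%:R - 1) 2)].
Proof.
move=> c t nu n_gt0 q_gt0 dE d0 d1'.
have d1 : d + 1 != 0 by rewrite dE subrK.
have q1 : nu + q%:R - 1 != 0 by exact: natr_add_pred_neq0.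
have q0 : nu + q%:R != 0 by rewrite -natrD pnatr_eq0; lia.
(* The shifts [e1], [e2] move the symbols in [a] down to the base [nu + a - 1], cancelling the
   prefactors. The shifts [e3], [e4] move the others up to the base [nu + 1]. These are the bases in
   [Lambda]. *)
have e1 := pochhammer_shift _ (nu + a) q.
have e2 := pochhammer_shift _ (nu + a - 1) q.
have e3 := pochhammer_shift _ nu q.
have e4 := pochhammer_shift _ (nu - 1) q.
rewrite !subrK in e2 e4.
rewrite !pochhammer2 /t /Lambda -/nu -/c.
have -> : nu - 1 + 1 = nu by ring.
have -> : nu - 2 + 1 = nu - 1 by ring.
have -> : nu - 1 + a + 1 = nu + a by ring.
have -> : nu - 2 + a + 1 = nu + a - 1 by ring.
have -> : nu + a - 1 + 1 = nu + a by ring.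
have -> : nu + q%:R - 1 + 1 = nu + q%:R by ring.
have e1' : (nu + a) * pochhammer (nu + a + 1) q = pochhammer (nu + a) q * (d + 1).
  by rewrite e1 dE; ring.
have e2' : (nu + a - 1) * pochhammer (nu + a) q = pochhammer (nu + a - 1) q * d.
  by rewrite e2 dE; ring.
split.
- transitivity (c * pochhammer (nu + 1) q
    * ((nu + a - 1) * ((nu + a) * pochhammer (nu + a + 1) q)) / (d * (d + 1))).
    by ring.
  by rewrite e1' (mulrA (nu + a - 1)) e2'; field; rewrite d0 d1.
- transitivity (c * pochhammer nu q * ((nu + a - 1) * pochhammer (nu + a) q) / d).
    by ring.
  rewrite e2' (_ : pochhammer nu q = nu * pochhammer (nu + 1) q / (nu + q%:R)).
    by field; rewrite q0 d0.
  by rewrite e3 mulfK.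
- rewrite (_ : pochhammer (nu - 1) q = (nu - 1)
      * (nu * pochhammer (nu + 1) q / (nu + q%:R)) / (nu + q%:R - 1)).
    by field; rewrite q0 q1.
  rewrite e3 mulfK // e4 (_ : nu - 1 + q%:R = nu + q%:R - 1) ?mulfK //; ring.
Qed.

(** * The limit of the Krall Hahn determinant, and its vanishing in low degree *)

Lemma cvg_det3 (R : realType) (u0 u1 u2 v0 v1 v2 w0 w1 w2 : nat -> R)
    (x0 x1 x2 y0 y1 y2 z0 z1 z2 : R) :
  u0 N @[N --> \oo] --> x0 -> u1 N @[N --> \oo] --> x1 ->
  u2 N @[N --> \oo] --> x2 ->
  v0 N @[N --> \oo] --> y0 -> v1 N @[N --> \oo] --> y1 ->
  v2 N @[N --> \oo] --> y2 ->
  w0 N @[N --> \oo] --> z0 -> w1 N @[N --> \oo] --> z1 ->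
  w2 N @[N --> \oo] --> z2 ->
  det3 (u0 N) (u1 N) (u2 N) (v0 N) (v1 N) (v2 N) (w0 N) (w1 N) (w2 N)
    @[N --> \oo] --> det3 x0 x1 x2 y0 y1 y2 z0 z1 z2.
Proof.
move=> cu0 cu1 cu2 cv0 cv1 cv2 cw0 cw1 cw2.
exact (cvgD (cvgB (cvgM cu0 (cvgB (cvgM cv1 cw2) (cvgM cv2 cw1)))
                  (cvgM cu1 (cvgB (cvgM cv0 cw2) (cvgM cv2 cw0))))
            (cvgM cu2 (cvgB (cvgM cv0 cw1) (cvgM cv1 cw0)))).
Qed.

Lemma horner_krall_hahn (F : fieldType) (k s : nat) (a b : F) (N n : nat)
    (z : F) :
  (krall_hahn k s a b N n).[z] =
  let nu : F := n%:R in
  let d1 := nu + a + b - 1 in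
  let d2 := pochhammer d1 2 in
  det3 (hahn a b N n%:Z).[z] (hahn a b N (n%:Z - 1)).[z]
    (hahn a b N (n%:Z - 2)).[z]
    (pochhammer (nu + b - 1) 2 / d2 * krall_S k b a N nu)
    ((nu + b - 1) / d1 * krall_S k b a N (nu - 1))
    (krall_S k b a N (nu - 2))
    (pochhammer (nu + a - 1) 2 / d2 * krall_S s a b N nu)
    (- ((nu + a - 1) / d1) * krall_S s a b N (nu - 1))
    (krall_S s a b N (nu - 2)).
Proof.
rewrite /krall_hahn det_mx_of_rows3 /= /det3.
by rewrite !(hornerD, hornerN, hornerM, hornerC).
Qed.

(** The orders [e], [f] and the row limits [S], [T] are left abstract so that all four combinations
    of generic and exceptional rows are covered at once. *)
Lemma krall_hahn_cvg (R : realType) (k s e f : nat) (a b x : R) (n : nat)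
    (S T : R -> R) :
  (forall y, krall_S k b a N y / N%:R ^+ e @[N --> \oo] --> S y) ->
  (forall y, krall_S s a b N y / N%:R ^+ f @[N --> \oo] --> T y) ->
  let nu : R := n%:R in
  let d1 := nu + a + b - 1 in
  let d2 := pochhammer d1 2 in
  (krall_hahn k s a b N n).[(1 - x) * N%:R / 2] / N%:R ^+ (e + f) @[N --> \oo] -->
  det3 (jacobi_int a b n%:Z).[x] (jacobi_int a b (n%:Z - 1)).[x]
    (jacobi_int a b (n%:Z - 2)).[x]
    (pochhammer (nu + b - 1) 2 / d2 * S nu)
    ((nu + b - 1) / d1 * S (nu - 1)) (S (nu - 2))
    (pochhammer (nu + a - 1) 2 / d2 * T nu)
    (- ((nu + a - 1) / d1) * T (nu - 1)) (T (nu - 2)).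
Proof.
move=> cS cT nu d1 d2.
apply: cvg_trans (cvg_det3 _ _ _ _ _ _ _ _ _ _ _ _ _ _ _ _ _ _ _
  (hahn_cvg _ a b x n%:Z) (hahn_cvg _ a b x (n%:Z - 1))
  (hahn_cvg _ a b x (n%:Z - 2))
  (cvgM (cvg_cst (pochhammer (nu + b - 1) 2 / d2)) (cS nu))
  (cvgM (cvg_cst ((nu + b - 1) / d1)) (cS (nu - 1))) (cS (nu - 2))
  (cvgM (cvg_cst (pochhammer (nu + a - 1) 2 / d2)) (cT nu))
  (cvgM (cvg_cst (- ((nu + a - 1) / d1))) (cT (nu - 1))) (cT (nu - 2))).
apply: near_eq_cvg; near=> N.
rewrite horner_krall_hahn /det3 /= -/nu -/d1 -/d2 exprD invfM.
move: (krall_S k b a N) (krall_S s a b N) (N%:R ^- e) (N%:R ^- f) => Sk Ss c c'.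
move: d2^-1 d1^-1 => D2 D1.
ring.
Unshelve. all: by end_near. Qed.

(** The column headed by h_{-1} is zero, since both dual Hahn values vanish at -1. It is the second
    column for [n = 0] and the third for [n = 1]. *)
Lemma krall_hahn_eq0 (F : fieldType) k s p q N n :
  (0 < p <= k)%N -> (0 < q <= s)%N -> (n < 2)%N ->
  krall_hahn k s (p%:R : F) q%:R N n = 0.
Proof.
move=> pk qs; rewrite /krall_hahn det_mx_of_rows3 /det3 /=.
case: n => [|[|//]] _.
  rewrite (sub0r 1) (@krall_S_predr0 _ k p) // (@krall_S_predr0 _ s q) // !mulr0.
  by rewrite (_ : 0%:Z - 1 = Negz 0) // (_ : 0%:Z - 2 = Negz 1) //=; ring.
rewrite (_ : 1 - 2 = -1 :> F); last by ring.
rewrite (@krall_S_predr0 _ k p) // (@krall_S_predr0 _ s q) // .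
by rewrite (_ : 1%:Z - 2 = Negz 0) //=; ring.
Qed.

(** * Evaluation of the limit determinants *)

Lemma intr_pred (F : pzRingType) (n : nat) : (n%:Z - 1)%:~R = n%:R - 1 :> F.
Proof. by rewrite intrB. Qed.

Lemma intr_pred2 (n : nat) : n%:Z - 1 - 1 = n%:Z - 2.
Proof. by lia. Qed.

Lemma pochhammer_subn_neq0 (F : idomainType) (c : F) k :
  (forall p : nat, (1 <= p <= k)%N -> c <> p%:R) -> pochhammer (c - k%:R) k != 0.
Proof.
move=> ck; apply/prodf_neq0 => i _.
rewrite (_ : c - k%:R + i%:R = c - (k - i)%:R); last first.
  by rewrite natrB 1?ltnW //; ring.
by rewrite subr_eq0; apply/eqP/ck; have := ltn_ord i; lia.
Qed.

(** Lowering [b] in degrees [n] and [n - 1], then [a] in degree [n], expresses the target through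
    the three Jacobi values of the first row, with the cofactors as coefficients. *)
Lemma det3_jacobi_generic (F : numFieldType) (a b x : F) (n : nat) (A B : F) :
  let nu : F := n%:R in
  let d1 := nu + a + b - 1 in
  d1 != 0 -> nu + a + b != 0 -> A != 0 -> B != 0 ->
  det3 (jacobi_int a b n%:Z).[x] (jacobi_int a b (n%:Z - 1)).[x]
    (jacobi_int a b (n%:Z - 2)).[x]
    (pochhammer (nu + b - 1) 2 / pochhammer d1 2 * A) ((nu + b - 1) / d1 * A) A
    (pochhammer (nu + a - 1) 2 / pochhammer d1 2 * B)
    (- ((nu + a - 1) / d1) * B) B / (A * B)
  = pochhammer (2 * nu + a + b - 2) 3 / ((nu + a + b) * d1 ^+ 2)
    * (jacobi (a - 1) (b - 1) n).[x].
Proof.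
move=> nu d1 d1_neq0 ab_neq0 A0 B0.
have := jacobi_int_pred_left F a (b - 1) x n.
have := jacobi_int_pred_right F a b x n.
have := jacobi_int_pred_right F a b x (n%:Z - 1).
rewrite intr_pred -pmulrn intr_pred2 -/nu.
have -> : (jacobi (a - 1) (b - 1) n).[x] =
  (jacobi_int (a - 1) (b - 1) n%:Z).[x] by [].
move: (jacobi_int _ _ n%:Z).[x] (jacobi_int (a - 1) (b - 1) n%:Z).[x]
  (jacobi_int a (b - 1) n%:Z).[x]
  (jacobi_int a b (n%:Z - 1)).[x] (jacobi_int a (b - 1) (n%:Z - 1)).[x]
  (jacobi_int a b (n%:Z - 2)).[x] => J0 J U J1 V J2 eV eU eJ.
(* The relations are used multiplied out, so the factors of (2n+a+b-2)_3, which may vanish, are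
   never divided by. *)
have key : pochhammer (2 * nu + a + b - 2) 3 * J =
    (2 * nu + a + b - 2) * d1 * ((nu + a + b) * J0 + (nu + a) * J1)
    - (nu + b - 1) * (2 * nu + a + b)
      * ((nu - 1 + a + b) * J1 + (nu - 1 + a) * J2).
  rewrite -eU -eV pochhammer_recr pochhammer2.
  transitivity ((2 * nu + a + b - 2) * (2 * nu + a + b)
    * ((2 * nu + a + (b - 1)) * J)).
    by ring.
  by rewrite eJ /d1; ring.
rewrite [RHS]mulrAC key /det3 !pochhammer2 /d1.
have d1' : nu + a + b - 1 + 1 != 0 by rewrite subrK.
by field; rewrite A0 B0 -/d1 d1_neq0 ab_neq0.
Qed.

(** Both Jacobi polynomials in [krall_jacobi (a - 1) q n] have first parameter [a - 1], so lowering
    [a] in degrees [n] and [n - 1] turns their combination into the determinant. *)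
Lemma det3_jacobi_krall (F : numFieldType) (a x : F) (n q : nat) (A L : F) :
  let nu : F := n%:R in
  let b : F := q%:R in
  let d1 := nu + a + b - 1 in
  (0 < n)%N -> (0 < q)%N -> d1 != 0 -> nu + a + b != 0 -> A != 0 ->
  det3 (jacobi_int a b n%:Z).[x] (jacobi_int a b (n%:Z - 1)).[x]
    (jacobi_int a b (n%:Z - 2)).[x]
    (pochhammer (nu + b - 1) 2 / pochhammer d1 2 * A) ((nu + b - 1) / d1 * A) A
    L (- (L * (nu / (nu + b))))
    (L * (pochhammer (nu - 1) 2 / pochhammer (nu + b - 1) 2)) / A
  = nu * (2 * nu + a + b - 2) * (2 * nu + a + b)
          / ((nu + b) * pochhammer (nu + a + b - 1) 2)
          * L * (krall_jacobi (a - 1) q n).[x].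
Proof.
move=> nu b d1 n0 q0 d1_neq0 ab_neq0 A0.
have nu0 : nu != 0 by rewrite pnatr_eq0 -lt0n.
have nb0 : nu + b != 0 by rewrite -natrD pnatr_eq0; lia.
have nb1 : nu + b - 1 != 0 by exact: natr_add_pred_neq0.
have := jacobi_int_pred_left F a b x n.
have := jacobi_int_pred_left F a b x (n%:Z - 1).
rewrite intr_pred -pmulrn intr_pred2 -/nu.
have -> : (krall_jacobi (a - 1) q n).[x] = (jacobi_int (a - 1) b n%:Z).[x]
    + (nu + b) / nu * (jacobi_int (a - 1) b (n%:Z - 1)).[x].
  rewrite /krall_jacobi hornerD (hornerZ (_ / _)) natrD.
  by rewrite (_ : n%:Z - 1 = n.-1) //; lia.
move: (jacobi_int _ _ n%:Z).[x] (jacobi_int (a - 1) b n%:Z).[x]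
  (jacobi_int a b (n%:Z - 1)).[x] (jacobi_int (a - 1) b (n%:Z - 1)).[x]
  (jacobi_int a b (n%:Z - 2)).[x] => J0 U J1 V J2 eV eU.
have d1' : nu + a + b - 1 + 1 != 0 by rewrite subrK.
transitivity ((nu * (2 * nu + a + b - 2) * ((2 * nu + a + b) * U)
    + (nu + b) * (2 * nu + a + b) * ((2 * (nu - 1) + a + b) * V))
    / ((nu + b) * pochhammer (nu + a + b - 1) 2) * L); last first.
  by rewrite !pochhammer2; field; do ![apply/andP; split].
rewrite eU eV /det3 !pochhammer2 /d1.
by field; do ![apply/andP; split].
Qed.

(** The mirror image of [det3_jacobi_krall]. Reflection moves the argument [- x] to [x], swaps the
    parameters and reverses the sign of the degree [n - 1] term, after which [b] is lowered instead
    of [a]. *)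
Lemma det3_jacobi_krall_opp (F : numFieldType) (b x : F) (n p : nat) (B L : F) :
  let nu : F := n%:R in
  let a : F := p%:R in
  let d1 := nu + a + b - 1 in
  (0 < n)%N -> (0 < p)%N -> d1 != 0 -> nu + a + b != 0 -> B != 0 ->
  det3 (jacobi_int a b n%:Z).[x] (jacobi_int a b (n%:Z - 1)).[x]
    (jacobi_int a b (n%:Z - 2)).[x]
    L (L * (nu / (nu + a)))
    (L * (pochhammer (nu - 1) 2 / pochhammer (nu + a - 1) 2))
    (pochhammer (nu + a - 1) 2 / pochhammer d1 2 * B)
    (- ((nu + a - 1) / d1) * B) B / B
  = nu * (2 * nu + a + b - 2) * (2 * nu + a + b)
          / ((-1) ^+ n * (nu + a) * pochhammer (nu + a + b - 1) 2)
          * L * (krall_jacobi (b - 1) p n).[- x].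
Proof.
move=> nu a d1 n0 p0 d1_neq0 ab_neq0 B0.
have nu0 : nu != 0 by rewrite pnatr_eq0 -lt0n.
have na0 : nu + a != 0 by rewrite -natrD pnatr_eq0; lia.
have na1 : nu + a - 1 != 0 by exact: natr_add_pred_neq0.
have := jacobi_int_pred_right F a b x n.
have := jacobi_int_pred_right F a b x (n%:Z - 1).
rewrite intr_pred -pmulrn intr_pred2 -/nu.
have -> : (krall_jacobi (b - 1) p n).[- x] =
    (-1) ^+ n * ((jacobi_int a (b - 1) n%:Z).[x]
    - (nu + a) / nu * (jacobi_int a (b - 1) (n%:Z - 1)).[x]).
  rewrite /krall_jacobi hornerD (hornerZ (_ / _)) natrD !jacobi_sym.
  rewrite (_ : n%:Z - 1 = n.-1); last lia.
  by rewrite -[in (-1) ^+ n](prednK n0) exprS /= -/a -/nu; ring.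
have s0 : (-1) ^+ n != 0 :> F by rewrite signr_eq0.
move: (jacobi_int _ _ n%:Z).[x] (jacobi_int a (b - 1) n%:Z).[x]
  (jacobi_int a b (n%:Z - 1)).[x] (jacobi_int a (b - 1) (n%:Z - 1)).[x]
  (jacobi_int a b (n%:Z - 2)).[x] => J0 U J1 V J2 eV eU.
have d1' : nu + a + b - 1 + 1 != 0 by rewrite subrK.
transitivity ((nu * (2 * nu + a + b - 2) * ((2 * nu + a + b) * U)
    - (nu + a) * (2 * nu + a + b) * ((2 * (nu - 1) + a + b) * V))
    / ((nu + a) * pochhammer (nu + a + b - 1) 2) * L); last first.
  by rewrite !pochhammer2; field; do ![apply/andP; split].
rewrite eU eV /det3 !pochhammer2 /d1.
by field; do ![apply/andP; split].
Qed.

Lemma det3_jacobi_krall2 (F : fieldType) (p q n : nat) (x K L : F) : (1 < n)%N ->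
  let nu : F := n%:R in
  det3 (jacobi_int p%:R q%:R n%:Z).[x]
    (jacobi_int p%:R q%:R (n%:Z - 1)).[x] (jacobi_int p%:R q%:R (n%:Z - 2)).[x]
    K (K * (nu / (nu + p%:R)))
    (K * (pochhammer (nu - 1) 2 / pochhammer (nu + p%:R - 1) 2))
    L (- (L * (nu / (nu + q%:R))))
    (L * (pochhammer (nu - 1) 2 / pochhammer (nu + q%:R - 1) 2)) =
  K * L * (krall_jacobi2 F p q n).[x].
Proof.
case: n => [//|[//|m]] _ nu.
have -> : m.+2%:Z - 1 = m.+1 by lia.
have -> : m.+2%:Z - 2 = m by lia.
rewrite /krall_jacobi2 det_mx_of_rows3 /det3 /jacobi_int -/nu.
move: (jacobi p%:R q%:R m.+2) (jacobi p%:R q%:R m.+1) (jacobi p%:R q%:R m).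
move=> J0 J1 J2; rewrite !(hornerD, hornerN, hornerM, hornerC).
by ring.
Qed.

Theorem lemma3p3 (R : realType) (kappa sigma : nat) (a b : R) (n : nat) (x : R)
  (kappa_gt0 : (0 < kappa)%N) (sigma_gt0 : (0 < sigma)%N)
  (a_nneg : forall j : nat, a <> - j.+1%:R)
  (b_nneg : forall j : nat, b <> - j.+1%:R)
  (ab_nneg : forall j : nat, a + b <> - j.+1%:R)
  (nab1_neq0 : n%:R + a + b - 1 <> 0) (nab_neq0 : n%:R + a + b <> 0)
  (deg_n : ~ (kappa%:R < a /\ sigma%:R < b) ->
    \forall N \near \oo, size (krall_hahn kappa sigma a b N n) = n.+1) :
  let H (N : nat) : R := (krall_hahn kappa sigma a b N n).[(1 - x) * N%:R / 2] in
  let nu : R := n%:R in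
  [/\ (* (i) *)
      (forall p : nat, (1 <= p <= kappa)%N -> a <> p%:R) ->
      (forall q : nat, (1 <= q <= sigma)%N -> b <> q%:R) ->
      H N / (pochhammer (a - kappa%:R) kappa * pochhammer (b - sigma%:R) sigma
               * N%:R ^+ (kappa + sigma)) @[N --> \oo] -->
        pochhammer (2 * nu + a + b - 2) 3
          / ((nu + a + b) * (nu + a + b - 1) ^+ 2)
          * (jacobi (a - 1) (b - 1) n).[x],
      (* (ii) *)
      forall q : nat,
      (forall p : nat, (1 <= p <= kappa)%N -> a <> p%:R) ->
      (1 <= q <= sigma)%N -> b = q%:R -> (1 <= n)%N ->
      H N / (pochhammer (a - kappa%:R) kappa * N%:R ^+ (kappa + sigma - q))
        @[N --> \oo] -->
        nu * (2 * nu + a + b - 2) * (2 * nu + a + b)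
          / ((nu + b) * pochhammer (nu + a + b - 1) 2)
          * Lambda sigma q a n * (krall_jacobi (a - 1) q n).[x],
      (* (iii) *)
      forall p : nat,
      (1 <= p <= kappa)%N -> a = p%:R ->
      (forall q : nat, (1 <= q <= sigma)%N -> b <> q%:R) -> (1 <= n)%N ->
      H N / (pochhammer (b - sigma%:R) sigma * N%:R ^+ (kappa + sigma - p))
        @[N --> \oo] -->
        nu * (2 * nu + a + b - 2) * (2 * nu + a + b)
          / ((-1) ^+ n * (nu + a) * pochhammer (nu + a + b - 1) 2)
          * Lambda kappa p b n * (krall_jacobi (b - 1) p n).[- x]
    & (* (iv) *)
      forall p q : nat,
      (1 <= p <= kappa)%N -> a = p%:R -> (1 <= q <= sigma)%N -> b = q%:R ->
      H N / N%:R ^+ (kappa + sigma - p - q) @[N --> \oo] -->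
        Lambda kappa p b n * Lambda sigma q a n * (krall_jacobi2 R p q n).[x] ].
Proof.
move=> H nu.
have d1_neq0 : nu + a + b - 1 != 0 by apply/eqP.
have ab_neq0 : nu + a + b != 0 by apply/eqP.
split.
- move=> /pochhammer_subn_neq0 A0 /pochhammer_subn_neq0 B0.
  rewrite -(det3_jacobi_generic _ _ _ x n _ _ d1_neq0 ab_neq0 A0 B0).
  under eq_cvg do rewrite invfM mulrCA mulrC.
  apply: cvgM; last exact: cvg_cst.
  exact: (krall_hahn_cvg R _ _ _ _ _ _ x n _ _
    (krall_S_cvg_generic R kappa b a)
    (krall_S_cvg_generic R sigma a b)).
- move=> q /pochhammer_subn_neq0 A0 /andP[q0 qs] bq n0.
  rewrite /H; clear H; subst b.
  rewrite -(det3_jacobi_krall _ _ x _ _ _ _ n0 q0 d1_neq0 ab_neq0 A0).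
  under eq_cvg do rewrite -addnBA // invfM mulrCA mulrC.
  apply: cvgM; last exact: cvg_cst.
  (* Rewriting backwards restores the unsimplified row limits, the form in which [krall_hahn_cvg]
     delivers them. *)
  have [<- <- <-] :=
    krall_S_limit_row _ sigma q n a _ n0 q0 erefl d1_neq0 ab_neq0.
  rewrite -mulNr.
  exact: (krall_hahn_cvg R _ _ _ _ _ _ x n _ _
    (krall_S_cvg_generic R kappa q%:R a)
    (krall_S_cvg_nat R sigma q a ^~ qs)).
- move=> p /andP[p0 pk] ap /pochhammer_subn_neq0 B0 n0.
  rewrite /H; clear H; subst a.
  rewrite -(det3_jacobi_krall_opp _ _ x _ _ _ _ n0 p0 d1_neq0 ab_neq0 B0).
  (* Since [p <= kappa], the truncated difference is [(kappa - p) + sigma], the sum of the orders of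
     the two rows. *)
  rewrite (addnC kappa) -addnBA // addnC.
  under eq_cvg do rewrite invfM mulrCA mulrC.
  apply: cvgM; last exact: cvg_cst.
  have dE : nu + p%:R + b - 1 = nu + b + p%:R - 1 by ring.
  rewrite addrAC in ab_neq0.
  have [<- <- <-] :=
    krall_S_limit_row _ kappa p n b _ n0 p0 dE d1_neq0 ab_neq0.
  exact: (krall_hahn_cvg R _ _ _ _ _ _ x n _ _
    (krall_S_cvg_nat R kappa p b ^~ pk)
    (krall_S_cvg_generic R sigma p%:R b)).
move=> p q /andP[p0 pk] ap /andP[q0 qs] bq; rewrite /H; clear H; subst a b.
(* Here [a = p <= kappa], so the degree assumption applies and provides some [N] with size [n + 1].
   For [n < 2] this contradicts the vanishing of the determinant. *)
have [n_lt2|n_gt1] := ltnP n 2.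
  have [|N] := @filter_ex _ _ _ _ (deg_n _).
    by rewrite !ltr_nat => -[]; rewrite ltnNge pk.
  by rewrite krall_hahn_eq0 ?p0 ?q0 // size_poly0.
have n0 : (0 < n)%N by exact: ltnW.
rewrite -det3_jacobi_krall2 // -/nu.
have -> : (kappa + sigma - p - q = (kappa - p) + (sigma - q))%N by lia.
have [<- <- <-] :=
  krall_S_limit_row _ sigma q n p%:R _ n0 q0 erefl d1_neq0 ab_neq0.
have dE : nu + p%:R + q%:R - 1 = nu + q%:R + p%:R - 1 by ring.
rewrite addrAC in ab_neq0.
have [<- <- <-] :=
  krall_S_limit_row _ kappa p n q%:R _ n0 p0 dE d1_neq0 ab_neq0.
rewrite -mulNr.
exact: (krall_hahn_cvg R _ _ _ _ _ _ x n _ _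
  (krall_S_cvg_nat R kappa p q%:R ^~ pk) (krall_S_cvg_nat R sigma q p%:R ^~ qs)).
Qed.
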